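(* For every $\varepsilon>0$ there exists a $\delta>0$ such that there is no mapping $\psi$ from undirected unweighted graphs $G$ on $n$ nodes to bitstrings of length $O(n^{4/3-\varepsilon})$ such that the distances of $G$ can always be recovered from the bitstring $\psi(G)$ within $+n^{\delta}$ additive error (i.e., such that there is a decoding procedure which, given $\psi(G)$ and two nodes $u,v$, outputs a value $d$ with $\mathrm{dist}_G(u,v)\le d\le \mathrm{dist}_G(u,v)+n^{\delta}$).
   Context: $\mathrm{dist}_G(u,v)$ denotes the shortest-path distance between $u$ and $v$ in $G$. Graphs on $n$ nodes are considered on a fixed labeled node set of size $n$. *)

(* Defs.v *)
From mathcomp Require Import all_boot all_order all_algebra.
From mathcomp Require Import all_classical all_reals all_analysis.

Set Implicit Arguments.
Unset Strict Implicit.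
Unset Printing Implicit Defensive.

Import Order.TTheory GRing.Theory Num.Theory.
Import numFieldNormedType.Exports.

Local Open Scope classical_set_scope.
Local Open Scope ring_scope.

Record ugraph (n : nat) := UGraph {
  adj :> rel 'I_n;
  adj_sym : symmetric adj;
  adj_irrefl : irreflexive adj
}.

(* A walk from [u] is given by the list [p] of the vertices visited after [u],
   so that [size p] is its number of edges.  The infimum is [+oo] when [v] is
   not reachable from [u]. *)
Definition dist (R : realType) (n : nat) (G : ugraph n) (u v : 'I_n) : \bar R :=
  ereal_inf [set ((size p)%:R)%:E |
             p in [set p : seq 'I_n | path (adj G) u p /\ last u p = v]].

Definition encoding := forall n : nat, ugraph n -> seq bool.

(* Bitstrings have length O(n^a): the constant is uniform over all graphs on
   [n] nodes. *)
Definition length_bigO (R : realType) (psi : encoding) (a : R) : Prop :=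
  exists C : R, \forall n \near \oo,
    forall G : ugraph n, (size (psi n G))%:R <= C * n%:R `^ a.

(* The decoder is an arbitrary function, which may depend on [n] and may return
   any extended real; in particular it must return [+oo] exactly on the pairs
   of nodes in distinct components. *)
Definition recovers_dist (R : realType) (psi : encoding) (delta : R) : Prop :=
  exists dec : forall n : nat, seq bool -> 'I_n -> 'I_n -> \bar R,
    forall (n : nat) (G : ugraph n) (u v : 'I_n),
      (dist R G u v <= dec n (psi n G) u v)%E /\
      (dec n (psi n G) u v <= dist R G u v + (n%:R `^ delta)%:E)%E.

(* Main.v *)
(* Take a layered graph whose bands [0 <= t <= B] have, from every node [y] of a
   finite group and for every direction [w], an edge to [y + dir t w].  Subdivide
   each such edge into [L] edges, and replace each node by bipartite connections
   between the edges [w] entering it and the edges [w'] leaving it.  A triple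
   [(x, w1, w2)] determines the route from [x] alternating between [w1] and [w2];
   it owns the connections it uses, and for a set [S] of triples one keeps only
   the connections owned by members of [S].  Even and odd bands translate by
   independent copies of points of a sphere, so by strict convexity no other
   route has the same ends: the distance between the ends of a route is the
   minimal one if the triple is in [S], and otherwise each of the [B] missing
   connections costs a step back, unless some edge is walked back entirely,
   which costs [L].  Hence distinct [S] need distinct codes, i.e. codes of about
   [|Z| |I|^2] bits on about [|Z| |I|] nodes, where [|Z|] is close to [|I|^2]. *)

Require Import Defs.
From mathcomp Require Import all_boot all_order all_algebra.
From mathcomp Require Import all_classical all_reals all_analysis.
From mathcomp Require Import zify ring lra.

Set Implicit Arguments.
Unset Strict Implicit.
Unset Printing Implicit Defensive.

Import Order.TTheory GRing.Theory Num.Theory.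

(** * The layered graph and the cost of walks in it *)

Section ObstacleGraph.

Variables (Z : finZmodType) (I : finType) (dir : nat -> I -> Z) (B L : nat).
Implicit Types (P : nat -> Z -> I -> I -> bool) (x : Z) (ws : nat -> I) (t : nat).

(** [(t, y, w, j)] is the [j]-th point of the subdivided edge leaving node [y] of band [t] in
    direction [w]; the nodes themselves are not vertices. *)
Definition vertex : Type := 'I_B.+1 * Z * I * 'I_L.+1.

Definition climbs (P : nat -> Z -> I -> I -> bool) : rel vertex :=
  fun '(t, y, w, j) '(t', y', w', j') =>
    [&& t' == t :> nat, y' == y, w' == w & j' == j.+1 :> nat] ||
    [&& t' == t.+1 :> nat, j == L :> nat, j' == 0 :> nat,
        y' == (y + dir t w)%R & P t y' w w'].

Definition neighbor P : rel vertex := fun u v => climbs P u v || climbs P v u.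

Definition height (v : vertex) : nat := let: (t, _, _, j) := v in t * L.+1 + j.

Lemma climbs_height P u v : climbs P u v -> height v = (height u).+1.
Proof.
case: u v => [[[t y] w] j] [[[t' y'] w'] j'] /=.
case/orP => [/and4P[/eqP -> _ _ /eqP ->]|/and5P[/eqP -> /eqP -> /eqP -> _ _]].
  by rewrite addnS.
by rewrite mulSn; lia.
Qed.

Lemma neighbor_sym P : symmetric (neighbor P).
Proof. by move=> u v; rewrite /neighbor orbC. Qed.

Lemma neighbor_irrefl P : irreflexive (neighbor P).
Proof.
move=> u; rewrite /neighbor orbb; apply/negP => /climbs_height; lia.
Qed.

Definition position (x : Z) (ws : nat -> I) (t : nat) : Z :=
  (x + \sum_(s < t) dir s (ws s))%R.

Lemma positionS x ws t : position x ws t.+1 = (position x ws t + dir t (ws t))%R.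
Proof. by rewrite /position big_ord_recr addrA. Qed.

Lemma eq_position x ws ws' t :
  (forall s, s < t -> ws s = ws' s) -> position x ws t = position x ws' t.
Proof. by move=> e; congr (_ + _)%R; apply: eq_bigr => s _; rewrite e. Qed.

Definition gaps P x ws t : nat :=
  \sum_(s < t) ~~ P s (position x ws s.+1) (ws s) (ws s.+1).

Lemma gapsS P x ws t : gaps P x ws t.+1 =
  gaps P x ws t + ~~ P t (position x ws t.+1) (ws t) (ws t.+1).
Proof. by rewrite /gaps big_ord_recr. Qed.

Lemma eq_gaps P x ws ws' t :
  (forall s, s <= t -> ws s = ws' s) -> gaps P x ws t = gaps P x ws' t.
Proof.
move=> e; apply: eq_bigr => s _; rewrite !e ?(ltnW (ltn_ord s)) //.
by rewrite (@eq_position _ ws ws') // => r; rewrite ltnS => /leq_trans le_r;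
   apply/e/le_r/ltnW.
Qed.

(* In a walk of [m] steps from height 0, [b] counts the descents.  Unless
   [L <= b], the edges fully crossed so far form a route [ws], and the walk is
   either on an edge leaving the head of the route, or has backed into an edge
   entering that head, which must be paid for by descents. *)
Definition walk_inv P x (m : nat) (v : vertex) : Prop :=
  let: (t, y, w, j) := v in
  exists b, m = height v + b.*2 /\
  (L <= b \/ exists ws,
     [/\ position x ws t = y, ws t = w, j < L & gaps P x ws t <= b] \/
     [/\ position x ws t.+1 = (y + dir t w)%R, 0 < j
       & gaps P x ws t + (L - j) + (w != ws t) <= b]).

Lemma walk_inv_climb P x m u v :
  climbs P u v -> walk_inv P x m u -> walk_inv P x m.+1 v.
Proof.
move=> uv; have := climbs_height uv.
case: u v uv => [[[t y] w] j] [[[t' y'] w'] j'] uv hv [b [-> hb]].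
exists b; split; first by rewrite hv.
case: hb => [|[ws hws]]; first by left.
have jL := ltn_ord j; have jL' := ltn_ord j'.
move: uv => /= /orP[].
  case/and4P=> /eqP -> /eqP -> /eqP -> /eqP j'E; right; exists ws.
  case: hws => [[py wt ltj le_b]|[py j_gt0 le_b]].
    (* Reaching [j' = L] completes the edge, and the second form takes over with [L - j' = 0]. *)
    have [lt|ge] := ltnP j' L; first by left.
    right; split; [by rewrite positionS py wt | by rewrite j'E |].
    by rewrite wt eqxx; lia.
  by right; split; [| by rewrite j'E | lia].
case/and5P=> /eqP -> /eqP jE /eqP j'E /eqP y'E Pt.
case: hws => [[_ _ +]|[py j_gt0 le_b]]; first by rewrite jE ltnn.
right; exists (fun s => if s == t.+1 then w' else ws s); left.
have pE : position x (fun s => if s == t.+1 then w' else ws s) t.+1 = y'.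
  rewrite y'E -py; apply: eq_position => s; by case: eqP => // ->; rewrite ltnn.
split; rewrite ?eqxx //; first lia.
rewrite gapsS pE eqxx (ltn_eqF (ltnSn t)) (@eq_gaps _ _ _ ws); last first.
  by move=> s; case: eqP => // ->; rewrite ltnn.
(* If [w = ws t], the connection just taken is present and adds no gap; otherwise the unit charged
   for [w != ws t] pays for a possible gap. *)
by case: eqP le_b => [<-|_]; rewrite ?Pt; lia.
Qed.

Lemma walk_inv_descend P x m u v :
  climbs P v u -> walk_inv P x m u -> walk_inv P x m.+1 v.
Proof.
move=> vu; have := climbs_height vu.
case: u v vu => [[[t y] w] j] [[[t' y'] w'] j'] vu hu [b [-> hb]].
exists b.+1; split; first by rewrite hu doubleS; lia.
case: hb => [|[ws hws]]; first by left; lia.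
have jL := ltn_ord j; have jL' := ltn_ord j'.
move: vu => /= /orP[].
  case/and4P=> /eqP tE /eqP yE /eqP wE /eqP jE; rewrite -tE -yE -wE.
  case: hws => [[py wt ltj le_b]|[py j_gt0 le_b]].
    by right; exists ws; left; split => //; lia.
  (* At [j' = 0] the edge has been walked back entirely: [L - 1] descents were already charged, and
     this one makes [L]. *)
  have [j'0|j'_gt0] := posnP j'; first by left; lia.
  by right; exists ws; right; split => //; lia.
case/and5P=> /eqP tE /eqP j'E /eqP jE /eqP yE _.
case: hws => [[py _ _ le_b]|[_ +]]; last by rewrite jE.
have [L0|L_gt0] := posnP L; first by left; lia.
right; exists ws; right; split; rewrite ?j'E //; first by rewrite -tE py.
(* Dropping the last connection can only lower [gaps], and the new descent pays for a possible
   [w' != ws t']. *)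
by move: le_b; rewrite tE gapsS; case: (_ != _); lia.
Qed.

Lemma walk_inv_path P x p m u :
  path (neighbor P) u p -> walk_inv P x m u -> walk_inv P x (m + size p) (last u p).
Proof.
elim: p m u => [|v p IHp] m u /=; first by rewrite addn0.
case/andP=> uv vp inv_u; rewrite addnS -addSn; apply: IHp => //.
by case/orP: uv => uv; [apply: walk_inv_climb inv_u | apply: walk_inv_descend inv_u].
Qed.

Lemma walk_lower_bound P x w y w' p : 0 < L ->
  path (neighbor P) (ord0, x, w, ord0) p ->
  last (ord0, x, w, ord0) p = (ord_max, y, w', ord_max) ->
  exists b, size p = B * L.+1 + L + b.*2 /\
    (L <= b \/ exists ws,
       position x ws B.+1 = (y + dir B w')%R /\ gaps P x ws B <= b).
Proof.
move=> L_gt0 pp lp.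
have /(walk_inv_path pp) : walk_inv P x 0 (ord0, x, w, ord0).
  exists 0; split=> //; right; exists (fun=> w); left.
  by split; rewrite // ?/position ?/gaps ?big_ord0 ?addr0.
rewrite lp add0n => -[b [-> hb]]; exists b; split => //.
case: hb => [|[ws [[_ _]|[py _ le_b]]]]; [by left | by rewrite ltnn |].
right; exists ws; split=> //; move: le_b => /=; lia.
Qed.

Lemma walk_along_route P x ws : gaps P x ws B = 0 ->
  exists p, [/\ path (neighbor P) (ord0, x, ws 0, ord0) p,
    last (ord0, x, ws 0, ord0) p = (ord_max, position x ws B, ws B, ord_max)
    & size p = B * L.+1 + L].
Proof.
move=> gap0; set u := (_, _, _, _).
suff walk t j : t <= B -> j <= L -> exists p, [/\ path (neighbor P) u p,
    last u p = (inord t, position x ws t, ws t, inord j) & size p = t * L.+1 + j].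
  have [p [pp lp szp]] := walk B L (leqnn _) (leqnn _); exists p; split=> //.
  by rewrite lp; congr (_, _, _, _); apply: val_inj; rewrite /= inordK.
elim: t j => [|t IHt] j; elim: j => [|j IHj] le_t le_j.
- exists [::]; split=> //=; rewrite /u /position big_ord0 addr0.
  by congr (_, _, _, _); apply: val_inj; rewrite /= inordK.
- have [p [pp lp sp]] := IHj le_t (ltnW le_j).
  exists (rcons p (inord 0, position x ws 0, ws 0, inord j.+1)).
  split; rewrite ?last_rcons ?size_rcons ?sp ?addnS // rcons_path pp lp /=.
  apply/orP; left; apply/orP; left.
  by rewrite !inordK ?eqxx //; lia.
- have [p [pp lp sp]] := IHt L (ltnW le_t) (leqnn _).
  exists (rcons p (inord t.+1, position x ws t.+1, ws t.+1, inord 0)).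
  split; rewrite ?last_rcons ?size_rcons ?sp //; last by rewrite mulSn; lia.
  rewrite rcons_path pp lp /=.
  apply/orP; left; apply/orP; right.
  rewrite !inordK // ?positionS ?eqxx //=; try lia.
  move/eqP: gap0; rewrite sum_nat_eq0 => /forallP /(_ (Ordinal le_t)) /=.
  by rewrite positionS eqb0 negbK.
- have [p [pp lp sp]] := IHj le_t (ltnW le_j).
  exists (rcons p (inord t.+1, position x ws t.+1, ws t.+1, inord j.+1)).
  split; rewrite ?last_rcons ?size_rcons ?sp ?addnS // rcons_path pp lp /=.
  apply/orP; left; apply/orP; left.
  by rewrite !inordK ?eqxx //; lia.
Qed.

End ObstacleGraph.

(** * Pigeonhole for code lengths *)

Lemma exists_long_code (T : finType) (code : T -> seq bool) (k : nat) :
  injective code -> 2 ^ k <= #|T| -> exists x, k <= (size (code x)).*2.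
Proof.
move=> code_inj le_k; apply/existsP; apply: contraLR le_k.
rewrite negb_exists -ltnNge => /forallP short.
have [k0|k_gt0] := posnP k.
  have T0 : #|T| = 0 by apply/eq_card0 => x; have := short x; rewrite k0.
  by rewrite T0 expn_gt0.
(* Padding with [None] to a common length [h] gives words over three letters; bounding [3 ^ h] by
   [2 ^ (2 h)] costs the factor two in the statement. *)
pose pad x : k.-1./2.-tuple (option bool) := [tuple onth (code x) i | i < k.-1./2].
have short' x : size (code x) <= k.-1./2.
  by rewrite geq_half_double; have := short x; lia.
have pad_inj : injective pad.
  move=> x y exy; apply/code_inj/eq_from_onth => i.
  have [lt_i|le_i] := ltnP i k.-1./2; last first.
    by rewrite !onth_default // (leq_trans (short' _)).
  by have := congr1 (fun s => tnth s (Ordinal lt_i)) exy; rewrite !tnth_mktuple.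
have := leq_card _ pad_inj; rewrite card_tuple card_option card_bool => leT.
apply: leq_ltn_trans leT _; apply: (@leq_ltn_trans (2 ^ k.-1./2.*2)).
  by rewrite -mul2n expnM; case: (k.-1./2) => // h; rewrite leq_exp2r.
by rewrite ltn_exp2l //; lia.
Qed.

(** * Storing a set of triples in the distances *)

Section Family.

Variables (Z : finZmodType) (I : finType) (dir : nat -> I -> Z) (B L : nat).
Implicit Types (S : {set Z * I * I}) (x : Z) (ws : nat -> I).

Local Notation pos := (position dir).

Definition alternate (w1 w2 : I) (s : nat) : I := if odd s then w2 else w1.

Definition in_family S (t : nat) (y : Z) (w w' : I) : bool :=
  [exists c in S, let: (x, w1, w2) := c in
    [&& pos x (alternate w1 w2) t.+1 == y, alternate w1 w2 t == w
      & alternate w1 w2 t.+1 == w']].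

Lemma gaps_in_family S x w1 w2 :
  (x, w1, w2) \in S -> gaps dir (in_family S) x (alternate w1 w2) B = 0.
Proof.
move=> xS; rewrite /gaps big1 // => s _; apply/eqP; rewrite eqb0 negbK.
by apply/exists_inP; exists (x, w1, w2); rewrite // !eqxx.
Qed.

Lemma alternate_inj t (w1 w2 v1 v2 : I) :
  alternate w1 w2 t = alternate v1 v2 t ->
  alternate w1 w2 t.+1 = alternate v1 v2 t.+1 -> w1 = v1 /\ w2 = v2.
Proof. by rewrite /alternate /=; case: odd. Qed.

(** Each connection has a single owner: its two directions determine [w1] and [w2], and its node
    then determines [x]. *)
Lemma gaps_notin_family S x w1 w2 : (x, w1, w2) \notin S ->
  gaps dir (in_family S) x (alternate w1 w2) B = B.
Proof.
move=> xS; rewrite /gaps -[RHS]card_ord -sum1_card; apply: eq_bigr => s _.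
apply/eqP; rewrite eqb1; apply/exists_inP => -[[[x' v1] v2] x'S].
case/and3P => /eqP ex /eqP e1 /eqP e2.
have [ew1 ew2] := alternate_inj e1 e2; case/negP: xS.
by move: ex x'S; rewrite ew1 ew2 => /addIr ->.
Qed.

Local Notation vertex := (vertex Z I B L).

Definition obstacle_graph S : ugraph #|{: vertex}| :=
  @UGraph _ (fun u v => neighbor dir (in_family S) (enum_val u) (enum_val v))
    (fun u v => neighbor_sym dir _ (enum_val u) (enum_val v))
    (fun u => neighbor_irrefl dir _ (enum_val u)).

Definition source x (w1 : I) : 'I_#|{: vertex}| :=
  enum_rank ((ord0, x, w1, ord0) : vertex).

Definition target x (w1 w2 : I) : 'I_#|{: vertex}| :=
  enum_rank ((ord_max, pos x (alternate w1 w2) B, alternate w1 w2 B, ord_max) : vertex).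

Variable R : realType.

Lemma dist_in_family S x w1 w2 : (x, w1, w2) \in S ->
  (dist R (obstacle_graph S) (source x w1) (target x w1 w2) <=
   ((B * L.+1 + L)%:R)%:E)%E.
Proof.
move=> xS; have [p [pp lp <-]] := walk_along_route L (gaps_in_family xS).
apply: ereal_inf_lbound; exists (map enum_rank p); last by rewrite size_map.
split; last by rewrite /source last_map lp.
rewrite /source path_map; apply: sub_path pp => u v /=.
by rewrite !enum_rankK.
Qed.

Hypothesis rigid : forall w1 w2 ws,
  (\sum_(s < B.+1) dir s (ws s) = \sum_(s < B.+1) dir s (alternate w1 w2 s))%R ->
  forall s, s <= B -> ws s = alternate w1 w2 s.
Hypothesis L_gt0 : 0 < L.

(** A walk with fewer than [L] descents yields a route with the same ends; by [rigid] it is the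
    route of the triple, whose [B] connections are all missing. *)
Lemma dist_notin_family S x w1 w2 : (x, w1, w2) \notin S ->
  (((B * L.+1 + L + (minn L B).*2)%:R)%:E <=
   dist R (obstacle_graph S) (source x w1) (target x w1 w2))%E.
Proof.
move=> xS; apply: le_ereal_inf_tmp => _ [p [pp lp] <-].
rewrite lee_fin ler_nat -(size_map enum_val).
have pp' : path (neighbor dir (in_family S)) (ord0, x, w1, ord0) (map enum_val p).
  by rewrite -[(_, _, _, _)]enum_rankK path_map.
have lp' : last (ord0, x, w1, ord0) (map enum_val p) =
    (ord_max, pos x (alternate w1 w2) B, alternate w1 w2 B, ord_max) :> vertex.
  by rewrite -[(ord0, _, _, _)]enum_rankK last_map lp enum_rankK.
have [b [-> hb]] := walk_lower_bound L_gt0 pp' lp'.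
rewrite leq_add2l leq_double; case: hb => [|[ws [pws le_b]]].
  by move=> le_b; rewrite geq_min le_b.
have wsE : forall s, s <= B -> ws s = alternate w1 w2 s.
  by apply: rigid; move: pws; rewrite -positionS => /addrI.
rewrite geq_min -(gaps_notin_family xS) (_ : gaps _ _ _ _ _ <= b) ?orbT //.
by rewrite -(eq_gaps _ _ _ wsE).
Qed.

(** Equal codes are decoded equally, so a triple in only one of the sets would force a decoding
    error of at least [2 * minn L B]. *)
Lemma family_code_inj (psi : encoding) (delta : R) :
  recovers_dist psi delta ->
  (#|{: vertex}|%:R `^ delta < (minn L B).*2%:R)%R ->
  injective (fun S => psi _ (obstacle_graph S)).
Proof.
move=> [dec decP] small.
have sub S S' : psi _ (obstacle_graph S) = psi _ (obstacle_graph S') ->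
    {subset S <= S'}.
  move=> eS [[x w1] w2] xS; apply: contraT => xS'.
  have [lo _] := decP _ (obstacle_graph S') (source x w1) (target x w1 w2).
  have [_ hi] := decP _ (obstacle_graph S) (source x w1) (target x w1 w2).
  rewrite -eS in lo; have := le_trans (dist_notin_family xS') (le_trans lo hi).
  move=> /le_trans /(_ (leeD2r _ (dist_in_family xS))).
  by rewrite -EFinD lee_fin natrD lerD2l leNgt small.
by move=> S S' eS; apply/setP => c; apply/idP/idP; apply: sub.
Qed.

Lemma long_code (psi : encoding) (delta : R) :
  recovers_dist psi delta ->
  (#|{: vertex}|%:R `^ delta < (minn L B).*2%:R)%R ->
  exists S, #|Z| * #|I| ^ 2 <= (size (psi _ (obstacle_graph S))).*2.
Proof.
move=> rec small; apply: (exists_long_code (family_code_inj rec small)).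
by rewrite -[leqRHS]cardsT -finset.powersetT card_powerset cardsT !card_prod -mulnA mulnn.
Qed.

End Family.

(** * Rigid directions from points of a sphere *)

(* Strict convexity of the sphere: the hypotheses give
   [\sum_j |a j - c|^2 = 0]. *)
Lemma centroid_rigid (J K : finType) (Q : pred J) (a : J -> K -> nat) (c : K -> nat) :
  (forall j, Q j -> \sum_k a j k ^ 2 = \sum_k c k ^ 2) ->
  (forall k, \sum_(j | Q j) a j k = \sum_(j | Q j) c k) ->
  forall j, Q j -> forall k, a j k = c k.
Proof.
move=> norm_a sum_a.
pose D j : int := (\sum_k ((a j k)%:Z - (c k)%:Z) ^+ 2)%R.
have D_ge0 j : Q j -> (0 <= D j)%R by move=> _; apply: sumr_ge0 => k _; apply: sqr_ge0.
(* Equal norms make [D j] affine in [a j], so its sum over [j] depends only on the sum of the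
   [a j]. *)
have DE j : Q j -> D j = (\sum_k (c k)%:Z * (c k)%:Z *+ 2 - \sum_k (c k)%:Z * (a j k)%:Z *+ 2)%R.
  move=> Qj; have /(congr1 Posz) := norm_a j Qj.
  rewrite !(big_morph Posz PoszD (erefl _)) => e.
  have -> : D j = (\sum_k (a j k ^ 2)%:Z + \sum_k (c k ^ 2)%:Z
                   - \sum_k (c k)%:Z * (a j k)%:Z *+ 2)%R.
    rewrite /D -big_split -sumrB /=; apply: eq_bigr => k _.
    by rewrite -!mulnn !PoszM; ring.
  by rewrite e -big_split; congr (_ - _)%R.
have : (\sum_(j | Q j) D j = 0)%R.
  rewrite (eq_bigr _ DE) sumrB; apply/eqP; rewrite subr_eq0; apply/eqP.
  rewrite exchange_big [RHS]exchange_big /=; apply: eq_bigr => k _.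
  rewrite !sumrMnl -!mulr_sumr; congr (_ * _ *+ _)%R.
  by rewrite -!(big_morph Posz PoszD (erefl _)) sum_a.
move/eqP; rewrite psumr_eq0 // => /allP D0 j Qj k.
have := D0 j (mem_index_enum _); rewrite Qj /= => /eqP/eqP.
rewrite psumr_eq0 => [/allP/(_ k (mem_index_enum _))|i _]; last exact: sqr_ge0.
by rewrite /= sqrf_eq0 subr_eq0 => /eqP[].
Qed.

Definition sphere (d q r : nat) : finType :=
  {x : {ffun 'I_d -> 'I_q} | \sum_k x k ^ 2 == r}.

(* Directions of odd and even bands live in complementary summands of the
   group, so that the alternating sums of both directions are read off
   independently. *)
Definition direction (d q r M s : nat) (w : sphere d q r) : 'M['Z_M]_(2, d) :=
  (\matrix_(i < 2, k < d) if i == odd s :> nat then (val w k : nat)%:R else 0)%R.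

(** On bands of one parity [alternate] is constant, hence the centroid of the [ws s] there, and
    [centroid_rigid] applies. *)
Lemma direction_rigid (d q r M B : nat) (w1 w2 : sphere d q r) (ws : nat -> sphere d q r) :
  0 < B -> 0 < q -> B.+1 * q <= M ->
  (\sum_(s < B.+1) direction M s (ws s) =
   \sum_(s < B.+1) direction M s (alternate w1 w2 s))%R ->
  forall s, s <= B -> ws s = alternate w1 w2 s.
Proof.
move=> B_gt0 q_gt0 le_M eq_sum s le_s.
have M_gt1 : 1 < M by nia.
(* At most [B.+1] digits below [q] are added, so nothing wraps around modulo [M]. *)
have digit_sum (vs : nat -> sphere d q r) (i : 'I_2) k :
    (\sum_(j < B.+1) direction M j (vs j))%R i k =
    \sum_(j < B.+1 | odd j == i :> nat) val (vs j) k :> nat.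
  rewrite summxE (eq_bigr (fun j : 'I_B.+1 =>
    if odd j == i :> nat then (val (vs j) k : nat)%:R else 0)%R) => [|j _]; last first.
    by rewrite mxE eq_sym.
  rewrite -big_mkcond -natr_sum val_Zp_nat // modn_small //.
  apply: leq_trans le_M; rewrite -[X in X * q]card_ord -sum_nat_const.
  rewrite big_mkcond /=; apply: (@leq_ltn_trans (\sum_(j < B.+1) q.-1)).
    apply: leq_sum => j _; case: ifP => // _.
    by rewrite -ltnS prednK.
  by rewrite !sum_nat_const card_ord; nia.
have odd2 : odd s < 2 by case: odd.
suff e : forall j : 'I_B.+1, odd j == odd s ->
    forall k, val (ws j) k = val (alternate w1 w2 s) k :> nat.
  apply/val_inj/ffunP => k; apply: val_inj.
  by apply: (e (Ordinal (le_s : s < B.+1)) (eqxx _)).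
apply: centroid_rigid => [j _|k].
  by rewrite (eqP (valP (ws j))) (eqP (valP (alternate w1 w2 s))).
have := digit_sum ws (Ordinal odd2) k; rewrite eq_sum digit_sum /= => e.
have eq_odd (j : 'I_B.+1) : (odd j == odd s :> nat) = (odd j == odd s).
  by case: odd; case: odd.
rewrite -(eq_bigl _ _ eq_odd) -e (eq_bigl _ _ eq_odd).
by apply: eq_bigr => j /eqP; rewrite /alternate => ->.
Qed.

Lemma card_sphere_le (d q r : nat) : #|sphere d q r| <= q ^ d.
Proof. by rewrite card_sig (leq_trans (max_card _)) // card_ffun !card_ord. Qed.

(** Pigeonhole: the [q ^ d] points have fewer than [d * q ^ 2 + 1] possible squared norms. *)
Lemma large_sphere (d q : nat) : 0 < d -> 0 < q ->
  exists r, q ^ d <= #|sphere d q r| * (d * q ^ 2).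
Proof.
move=> d_gt0 q_gt0; pose N (x : {ffun 'I_d -> 'I_q}) := \sum_k x k ^ 2.
have N_lt x : N x < d * q ^ 2.
  rewrite -[d in d * _]card_ord -sum_nat_const.
  apply: (@leq_ltn_trans (\sum_(k < d) q.-1 ^ 2)).
    by apply: leq_sum => k _; rewrite leq_exp2r //; have := ltn_ord (x k); lia.
  by rewrite !sum_nat_const card_ord; nia.
apply/not_existsP => small.
have : q ^ d = \sum_(r < d * q ^ 2) #|sphere d q r|.
  rewrite -[in LHS](card_ord q) -[d in LHS]card_ord -card_ffun -sum1_card.
  rewrite (partition_big (fun x => Ordinal (N_lt x)) predT) //=.
  by apply: eq_bigr => r _; rewrite card_sig -sum1_card; apply: eq_bigl => x.
move=> sum_q; have : q ^ d * (d * q ^ 2) <= \sum_(r < d * q ^ 2) (q ^ d).-1.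
  rewrite {1}sum_q big_distrl /=; apply: leq_sum => r _.
  by rewrite -ltnS prednK ?expn_gt0 ?q_gt0 // ltnNge; apply/negP/(small r).
rewrite sum_nat_const card_ord mulnC leq_pmul2l ?muln_gt0 ?d_gt0 ?expn_gt0 ?q_gt0 //.
by rewrite leqNgt prednK ?leqnn // expn_gt0 q_gt0.
Qed.

(** * Choice of parameters *)

Local Open Scope ring_scope.

(** Cubing clears the exponent [4 / 3]. The gain [n ^ (3 eps)] is at least [g ^ (18 (d + 1))], while
    [z / w ^ 2] and the factors [g] of [n] lose only [g ^ (6 d + 8)] up to constants. *)
Lemma parameter_bound (R : realType) (eps C : R) (d g z w : nat) :
  (0 < d)%N -> (0 < g)%N -> (0 < w)%N -> 3 <= eps * d%:R ->
  z = (g ^ (2 * d * d.+1))%N -> ((g ^ d) ^ d <= w * (d * (g ^ d) ^ 2))%N ->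
  (z * w ^ 2)%:R <= 2 * C * (g * z * w * g.+1)%:R `^ (4 / 3 - eps) ->
  g%:R <= 128 * C ^+ 3 * d%:R ^+ 2.
Proof.
move=> d_gt0 g_gt0 w_gt0 eps_d zE large_w; set n := (g * z * w * g.+1)%N.
set X := _ `^ _ => le_k.
have z_gt0 : (0 < z)%N by rewrite zE expn_gt0 g_gt0.
have n_ge1 : 1 <= n%:R :> R by rewrite ler1n !muln_gt0 g_gt0 z_gt0 w_gt0.
have n_gt0 : 0 < n%:R :> R by apply: lt_le_trans n_ge1.
have dR_gt0 : 0 < d%:R :> R by rewrite ltr0n.
have XE : X ^+ 3 * n%:R `^ (3 * eps) = n%:R ^+ 4.
  rewrite /X -powR_mulrn ?powR_ge0 // -powRrM -powRD; last first.
    by rewrite (gt_eqF n_gt0) implybT.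
  by rewrite -powR_mulrn ?ltW //; congr (_ `^ _); field.
have T_ge : (g ^ (18 * d.+1))%:R <= n%:R `^ (3 * eps) :> R.
  have le_zn : z%:R <= n%:R :> R.
     rewrite ler_nat (_ : n = z * (g * w * g.+1))%N ?leq_pmulr ?muln_gt0 ?g_gt0 ?w_gt0 //.
    by rewrite /n (mulnC g z) !mulnA.
  have -> : (g ^ (18 * d.+1))%:R = z%:R `^ (9 / d%:R) :> R.
    rewrite zE !natrX -!powR_mulrn // -powRrM; congr (_ `^ _).
    by rewrite !natrM; field; rewrite gt_eqF.
  apply: (@le_trans _ _ (n%:R `^ (9 / d%:R))).
    by apply: ge0_ler_powR; rewrite ?nnegrE ?divr_ge0 ?ler0n.
  by apply: ler_powR => //; rewrite ler_pdivrMr //; lra.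
(* No sign of [C] is assumed; the positive left side of [le_k] forces it. *)
have C_gt0 : 0 < C.
  have X_gt0 : 0 < X by rewrite powR_gt0.
  have k_gt0 : 0 < (z * w ^ 2)%:R :> R by rewrite ltr0n muln_gt0 z_gt0 expn_gt0 w_gt0.
  have : 0 < 2 * C * X by apply: lt_le_trans le_k.
  by rewrite pmulr_lgt0 // pmulr_rgt0.
have cubed : (z * w ^ 2)%:R ^+ 3 * (g ^ (18 * d.+1))%:R <= 8 * C ^+ 3 * n%:R ^+ 4.
  rewrite -XE mulrA; apply: ler_pM => //.
  have -> : 8 * C ^+ 3 * X ^+ 3 = (2 * C * X) ^+ 3 by ring.
  by rewrite lerXn2r ?nnegrE // (le_trans _ le_k).
have n_le : n%:R <= (2 * g ^ 2 * z * w)%:R :> R.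
  have -> : (2 * g ^ 2 * z * w = g * z * w * (g + g))%N by rewrite -mulnn; lia.
  by rewrite ler_nat leq_mul2l -[g.+1]addn1 leq_add2l g_gt0 orbT.
have step1 : (w ^ 2 * g ^ (18 * d.+1))%:R <= 128 * C ^+ 3 * (g ^ 8 * z)%:R.
  have /ler_pM2l <- : 0 < (z ^ 3 * w ^ 4)%:R :> R.
    by rewrite ltr0n muln_gt0 !expn_gt0 z_gt0 w_gt0.
  have -> : (z ^ 3 * w ^ 4)%:R * (w ^ 2 * g ^ (18 * d.+1))%:R =
            (z * w ^ 2)%:R ^+ 3 * (g ^ (18 * d.+1))%:R :> R.
    by rewrite !(natrM, natrX); ring.
  apply: (le_trans cubed).
  have -> : (z ^ 3 * w ^ 4)%:R * (128 * C ^+ 3 * (g ^ 8 * z)%:R) =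
            8 * C ^+ 3 * (2 * g ^ 2 * z * w)%:R ^+ 4.
    by rewrite !(natrM, natrX); ring.
  apply: ler_wpM2l; first by rewrite mulr_ge0 ?exprn_ge0 ?ltW.
  by apply: lerXn2r; rewrite ?nnegrE ?ler0n.
have step2 : (g ^ (2 * d * d + 18 * d.+1))%:R <=
    128 * C ^+ 3 * d%:R ^+ 2 * (g ^ (2 * d * d + 6 * d + 8))%:R.
  have -> : 128 * C ^+ 3 * d%:R ^+ 2 * (g ^ (2 * d * d + 6 * d + 8))%:R =
            (d * (g ^ d) ^ 2)%:R ^+ 2 * (128 * C ^+ 3 * (g ^ 8 * z)%:R).
    have -> : (2 * d * d + 6 * d + 8 = 2 * d * d.+1 + 4 * d + 8)%N by lia.
    rewrite zE !expnD; move: (g ^ d)%N (g ^ (2 * d * d.+1))%N => a b.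
    by rewrite !(natrM, natrX); ring.
  apply: (@le_trans _ _ ((d * (g ^ d) ^ 2)%:R ^+ 2 * (w ^ 2 * g ^ (18 * d.+1))%:R)).
    have E : (g ^ (2 * d * d) = ((g ^ d) ^ d) ^ 2)%N.
      by rewrite -!expnM; congr (g ^ _)%N; lia.
    rewrite -natrX -natrM ler_nat expnD E mulnA leq_mul2r -expnMn leq_exp2r //.
    by rewrite (mulnC _ w) large_w orbT.
  by apply: ler_wpM2l.
have : (g ^ (12 * d + 10))%:R <= 128 * C ^+ 3 * d%:R ^+ 2.
  have /ler_pM2r <- : 0 < (g ^ (2 * d * d + 6 * d + 8))%:R :> R.
    by rewrite ltr0n expn_gt0 g_gt0.
  apply: le_trans step2; rewrite -natrM -expnD.
  by have -> : (12 * d + 10 + (2 * d * d + 6 * d + 8) = 2 * d * d + 18 * d.+1)%N by lia.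
apply: le_trans; rewrite ler_nat -[leqLHS]expn1 leq_pexp2l //; lia.
Qed.

Theorem theorem2 (R : realType) (eps : R) (heps : 0 < eps) :
  exists delta : R, 0 < delta /\
    ~ (exists psi : encoding,
         length_bigO psi (4 / 3 - eps) /\ recovers_dist psi delta).
Proof.
have [d d_gt0 eps_d] : exists2 d, (0 < d)%N & 3 <= eps * d%:R.
  exists (Num.trunc (3 / eps)).+1 => //.
  by rewrite mulrC -ler_pdivrMr // ltW // truncnS_gt.
(* Chosen so that [n <= g ^ E]: the bands give [g], the group [g ^ (2 d (d + 1))], the sphere at
   most [g ^ (d d)], and [g.+1] at most [g ^ 2]. *)
pose E := (3 + 2 * d * d.+1 + d * d)%N.
exists (E%:R^-1); split; first by rewrite invr_gt0 ltr0n.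
move=> [psi [[C [N0 _ short]] rec]].
(* [3 <= g] gives [g < 2 (g - 1)], which bounds the error; [N0 <= g <= n] makes the length bound
   available; the last condition contradicts [parameter_bound]. *)
have [g [g_ge3 g_geN0 g_large]] : exists g,
    [/\ (3 <= g)%N, (N0 <= g)%N & 128 * C ^+ 3 * d%:R ^+ 2 < g%:R].
  exists (maxn 3 (maxn N0 (Num.trunc (128 * C ^+ 3 * d%:R ^+ 2)).+1)).
  rewrite !leq_max !leqnn !orbT; split=> //.
  by apply: lt_le_trans (truncnS_gt _) _; rewrite ler_nat !leq_max leqnn !orbT.
have g_gt0 : (0 < g)%N by apply: leq_trans g_ge3.
have q_gt0 : (0 < g ^ d)%N by rewrite expn_gt0 g_gt0.
have [r large_w] := large_sphere d_gt0 q_gt0.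
(* With [B = g - 1] and [q = g ^ d], this [M] is exactly [B.+1 * q]. *)
pose I := sphere d (g ^ d) r; pose M := (g * g ^ d)%N; pose Z := 'M['Z_M]_(2, d).
have zE : #|{: Z}| = (g ^ (2 * d * d.+1))%N.
  have M_gt1 : (1 < M)%N by rewrite /M; nia.
  by rewrite card_mx card_ord Zp_cast // /M -expnS -expnM; congr (g ^ _)%N; lia.
have w_gt0 : (0 < #|{: I}|)%N.
  have : (0 < (g ^ d) ^ d)%N by rewrite expn_gt0 q_gt0.
  by move=> /leq_trans /(_ large_w); rewrite muln_gt0 => /andP[].
have nE : #|{: vertex Z I g.-1 g}| = (g * #|{: Z}| * #|{: I}| * g.+1)%N.
  by rewrite !card_prod !card_ord prednK.
have n_le : (#|{: vertex Z I g.-1 g}| <= g ^ E)%N.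
  have -> : (g ^ E = g * g ^ (2 * d * d.+1) * g ^ (d * d) * g ^ 2)%N.
    by rewrite -[X in (_ = X * _ * _ * _)%N]expn1 -!expnD; congr (g ^ _)%N; rewrite /E; lia.
  rewrite nE zE !leq_mul //; first by rewrite expnM card_sphere_le.
  by rewrite -mulnn; nia.
have small : #|{: vertex Z I g.-1 g}|%:R `^ (E%:R^-1) < (minn g g.-1).*2%:R :> R.
  apply: (@le_lt_trans _ _ g%:R); last by rewrite ltr_nat; lia.
  apply: (@le_trans _ _ ((g ^ E)%:R `^ (E%:R^-1))).
    by apply: ge0_ler_powR; rewrite ?nnegrE ?invr_ge0 ?ler0n ?ler_nat.
  by rewrite natrX -powR_mulrn // -powRrM divff ?powRr1 // pnatr_eq0.
have rigid (w1 w2 : I) (ws : nat -> I) :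
    \sum_(s < g.-1.+1) direction M s (ws s) =
    \sum_(s < g.-1.+1) direction M s (alternate w1 w2 s) ->
    forall s, (s <= g.-1)%N -> ws s = alternate w1 w2 s.
  by apply: direction_rigid; rewrite ?prednK //; lia.
have [S] := long_code rigid g_gt0 rec small.
set code := psi _ _ => le_code.
have le_n : (N0 <= #|{: vertex Z I g.-1 g}|)%N.
  rewrite (leq_trans g_geN0) // nE -!mulnA leq_pmulr //.
  by rewrite !muln_gt0 zE expn_gt0 g_gt0 w_gt0.
have : g%:R <= 128 * C ^+ 3 * d%:R ^+ 2.
  apply: (parameter_bound (w := #|{: I}|) _ _ _ eps_d zE large_w) => //.
  apply: (@le_trans _ _ (2 * (size code)%:R)); first by rewrite -natrM mul2n ler_nat.
  by rewrite -nE -mulrA ler_wpM2l // short.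
by rewrite leNgt g_large.
Qed.
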